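(* The Sierpiński space does not contain copies of $c_0(\ell_1)$; that is, for every bijection $f:\mathbb{N}\to\mathbb{Q}$, no closed subspace of $X_f$ is isomorphic (linearly homeomorphic) to $c_0(\ell_1)$.
   Context: For a bijection $f:\mathbb{N}\to\mathbb{Q}$, let $\mathcal{C}_f$ be the family of all finite sets $F\subseteq\mathbb{N}$ on which $f$ is increasing (i.e. $n<k$ in $F$ implies $f(n)<f(k)$). For $x\in\mathbb{R}^{\mathbb{N}}$ let $\|x\|_f=\sup\{\sum_{i\in F}|x(i)|:F\in\mathcal{C}_f\}$. The Sierpiński space is $X_f=\{x\in\mathbb{R}^{\mathbb{N}}:\|x\cdot\chi_{[n,\infty)}\|_f\to0\}$ with norm $\|\cdot\|_f$ (up to isomorphism it does not depend on $f$). $c_0(\ell_1)$ is the $c_0$-sum of countably infinitely many copies of $\ell_1$. *)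

(* Defs.v *)
From HB Require Import structures.
From mathcomp Require Import all_boot all_order all_algebra finmap.
From mathcomp Require Import all_classical all_reals all_analysis.
Set Implicit Arguments.
Unset Strict Implicit.
Unset Printing Implicit Defensive.
Import Order.TTheory GRing.Theory Num.Theory.
Import numFieldNormedType.Exports.
Local Open Scope classical_set_scope.
Local Open Scope ring_scope.

Definition increasing_sets (f : nat -> rat) : set {fset nat} :=
  [set F | {in F &, {homo f : n k / (n < k)%N >-> n < k}}].

Section sierpinski_norm.
Context {R : realType} (f : nat -> rat).
Implicit Types (x y : nat -> R) (F : {fset nat}).

Definition sierpinski_norm x : \bar R :=
  ereal_sup [set (\sum_(i <- F) `|x i|)%:E | F in increasing_sets f].

(* x . chi_[n, oo) *)
Definition sierpinski_tail x (n : nat) : nat -> R :=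
  x \* \1_[set k | (n <= k)%N].

Lemma sierpinski_tailE x n i : sierpinski_tail x n i = x i * (n <= i)%:R.
Proof.
rewrite /sierpinski_tail/= indicE; congr (_ * (nat_of_bool _)%:R).
by apply/idP/idP; rewrite inE.
Qed.

Lemma sierpinski_norm_ub x F : increasing_sets f F ->
  ((\sum_(i <- F) `|x i|)%:E <= sierpinski_norm x)%E.
Proof. by move=> Ff; apply: ereal_sup_ubound; exists F. Qed.

Lemma increasing_sets0 : increasing_sets f fset0.
Proof. by move=> n k; rewrite inE. Qed.

Lemma increasing_sets1 i : increasing_sets f [fset i]%fset.
Proof. by move=> n k; rewrite !inE => /eqP -> /eqP ->; rewrite ltnn. Qed.

Lemma sierpinski_norm_ge0 x : (0 <= sierpinski_norm x)%E.
Proof.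
by have := sierpinski_norm_ub x increasing_sets0; rewrite big_nil.
Qed.

Lemma sierpinski_norm_coord x i : (`|x i|%:E <= sierpinski_norm x)%E.
Proof.
have := sierpinski_norm_ub x (@increasing_sets1 i).
by rewrite big_seq_fset1.
Qed.

Lemma sierpinski_normD x y :
  (sierpinski_norm (x + y)%R <= sierpinski_norm x + sierpinski_norm y)%E.
Proof.
apply: ge_ereal_sup => _ [F Ff <-].
apply: (@le_trans _ _
  ((\sum_(i <- F) `|x i|)%:E + (\sum_(i <- F) `|y i|)%:E)%E); last first.
  by apply: leeD; exact: sierpinski_norm_ub.
by rewrite -EFinD lee_fin -big_split ler_sum// => i _; exact: ler_normD.
Qed.

Lemma sierpinski_normZ (a : R) x :
  sierpinski_norm (a *: x) = (`|a|%:E * sierpinski_norm x)%E.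
Proof.
rewrite /sierpinski_norm -ereal_supZl//; last first.
  by apply/set0P; exists (\sum_(i <- fset0) `|x i|)%:E; exists fset0 => //;
    exact: increasing_sets0.
congr ereal_sup; rewrite [RHS]image_comp; apply: eq_imagel => F _ /=.
rewrite -EFinM mulr_sumr; congr EFin.
by apply: eq_bigr => i _; rewrite -normrM.
Qed.

Lemma sierpinski_tail0 x : sierpinski_tail x 0 = x.
Proof. by apply/funext => i; rewrite sierpinski_tailE mulr1. Qed.

Lemma sierpinski_tailD x y n :
  sierpinski_tail (x + y) n = sierpinski_tail x n + sierpinski_tail y n.
Proof. by apply/funext => i; rewrite /sierpinski_tail/= mulrDl. Qed.

Lemma sierpinski_tailZ (a : R) x n :
  sierpinski_tail (a *: x) n = a *: sierpinski_tail x n.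
Proof. by apply/funext => i; exact: (esym (mulrA _ _ _)). Qed.

Lemma sierpinski_tail_lty x n :
  (sierpinski_norm (sierpinski_tail x n) < +oo -> sierpinski_norm x < +oo)%E.
Proof.
elim: n => [|n IHn]; first by rewrite sierpinski_tail0.
move=> xn; apply: IHn.
pose e : nat -> R := fun i => x n *+ (i == n).
have -> : sierpinski_tail x n = sierpinski_tail x n.+1 + e.
  apply/funext => i.
  have -> : (sierpinski_tail x n.+1 + e) i = sierpinski_tail x n.+1 i + e i.
    by [].
  rewrite !sierpinski_tailE /e.
  have [->|ni] := eqVneq i n; first by rewrite leqnn ltnn mulr0 mulr1 add0r.
  by rewrite addr0 leq_eqVlt eq_sym (negPf ni).
apply: le_lt_trans (sierpinski_normD _ _) _; apply: lte_add_pinfty => //.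
apply: (@le_lt_trans _ _ (`|x n|)%:E); last exact: ltry.
apply: ge_ereal_sup => _ [F _ <-]; rewrite lee_fin.
have en : e n = x n by rewrite /e eqxx.
have e0 i : i != n -> e i = 0 by rewrite /e => /negPf ->.
have [nF|nF] := boolP (n \in F).
  rewrite (bigD1_seq n) ?fset_uniq//= en big1 ?addr0// => i /e0 ->.
  by rewrite normr0.
rewrite big_seq big1// => i iF; rewrite e0 ?normr0//.
by apply: contraNneq nF => <-.
Qed.

End sierpinski_norm.

Section sierpinski.
Context (R : realType) (f : nat -> rat).

Definition sierpinski_set : set (nat -> R) :=
  [set x | sierpinski_norm f (sierpinski_tail x n) @[n --> \oo] --> 0%E].

Definition sierpinski_pred : {pred nat -> R} := mem sierpinski_set.

Record sierpinski := Sierpinski {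
  sierpinski_val :> nat -> R;
  sierpinski_valP : sierpinski_val \in sierpinski_pred }.

HB.instance Definition _ := [isSub for sierpinski_val].
HB.instance Definition _ := [Choice of sierpinski by <:].

Lemma sierpinski_submod_closed : submod_closed sierpinski_pred.
Proof.
split.
  apply/mem_set; rewrite /sierpinski_set/=.
  have E n : sierpinski_norm f (sierpinski_tail (0 : nat -> R) n) = 0%E.
    have -> : sierpinski_tail (0 : nat -> R) n = 0.
      by apply/funext => i; rewrite sierpinski_tailE mul0r.
    by rewrite -(scale0r (0 : nat -> R)) sierpinski_normZ normr0 mul0e.
  by rewrite (_ : (fun n => _) = cst 0%E); [exact: cvg_cst|apply/funext].
move=> a x y /set_mem xX /set_mem yX; apply/mem_set.
rewrite /sierpinski_set/=.
apply: (@squeeze_cvge _ _ _ _ (cst 0%E) _ (fun n =>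
  `|a|%:E * sierpinski_norm f (sierpinski_tail x n) +
  sierpinski_norm f (sierpinski_tail y n))%E).
- apply: nearW => n; rewrite sierpinski_norm_ge0/=.
  rewrite sierpinski_tailD sierpinski_tailZ -sierpinski_normZ.
  exact: sierpinski_normD.
- exact: cvg_cst.
- rewrite -[X in _ --> X]adde0; apply: cvgeD => //.
  by rewrite -(mule0 `|a|%:E); exact: cvgeZl.
Qed.

HB.instance Definition _ :=
  GRing.isSubmodClosed.Build _ _ sierpinski_pred sierpinski_submod_closed.
HB.instance Definition _ := [SubChoice_isSubLmodule of sierpinski by <:].

Lemma sierpinski_norm_fin_num (x : sierpinski) :
  sierpinski_norm f x \is a fin_num.
Proof.
rewrite ge0_fin_numE ?sierpinski_norm_ge0//.
have /set_mem xX := sierpinski_valP x.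
have [[n _ xn] _] := (fine_cvgP _ _).1 xX.
apply: (@sierpinski_tail_lty _ _ _ n).
by rewrite -ge0_fin_numE ?sierpinski_norm_ge0//; apply: xn => /=.
Qed.

Let nrm (x : sierpinski) : R := fine (sierpinski_norm f x).

Let nrmE x : (nrm x)%:E = sierpinski_norm f x.
Proof. by rewrite /nrm fineK// sierpinski_norm_fin_num. Qed.

Let nrmD x y : nrm (x + y) <= nrm x + nrm y.
Proof. by rewrite -lee_fin EFinD !nrmE; exact: sierpinski_normD. Qed.

Let nrmZ a x : nrm (a *: x) = `|a| * nrm x.
Proof. by apply: EFin_inj; rewrite EFinM !nrmE; exact: sierpinski_normZ. Qed.

Let nrm0_eq0 x : nrm x = 0 -> x = 0.
Proof.
move=> x0; apply/val_inj/funext => i.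
suff /eqP : x i == 0 by [].
rewrite -normr_le0 -lee_fin -x0 nrmE; exact: sierpinski_norm_coord.
Qed.

HB.instance Definition _ :=
  Lmodule_isNormed.Build R sierpinski nrmD nrmZ nrm0_eq0.

Lemma sierpinski_normE (x : sierpinski) : `|x| = fine (sierpinski_norm f x).
Proof. by []. Qed.

End sierpinski.

Section ell1.
Context (R : realType).
Implicit Types x y : nat -> R.

Definition ell1_norm x : \bar R := (\sum_(0 <= k <oo) `|x k|%:E)%E.

Definition ell1_set : set (nat -> R) := [set x | (ell1_norm x < +oo)%E].

Definition ell1_pred : {pred nat -> R} := mem ell1_set.

Record ell1 := Ell1 {
  ell1_val :> nat -> R;
  ell1_valP : ell1_val \in ell1_pred }.

HB.instance Definition _ := [isSub for ell1_val].
HB.instance Definition _ := [Choice of ell1 by <:].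

Lemma ell1_norm_ge0 x : (0 <= ell1_norm x)%E.
Proof. by apply: nneseries_ge0 => n _ _; rewrite lee_fin. Qed.

Lemma ell1_norm_coord x i : (`|x i|%:E <= ell1_norm x)%E.
Proof.
apply: (@le_trans _ _ (\sum_(0 <= k < i.+1) `|x k|%:E)%E); last first.
  by apply: nneseries_lim_ge => n _ _; rewrite lee_fin.
by rewrite big_nat_recr//= leeDr// sume_ge0// => n _; rewrite lee_fin.
Qed.

Lemma ell1_normD x y : (ell1_norm (x + y)%R <= ell1_norm x + ell1_norm y)%E.
Proof.
rewrite /ell1_norm -nneseriesD//; [|by move=> *; rewrite lee_fin..].
apply: lee_nneseries => [n _ _|n _]; first by rewrite lee_fin.
by rewrite -EFinD lee_fin; exact: ler_normD.
Qed.

Lemma ell1_normZ (a : R) x : ell1_norm (a *: x) = (`|a|%:E * ell1_norm x)%E.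
Proof.
rewrite /ell1_norm -nneseriesZl; last by move=> *; rewrite lee_fin.
by apply: eq_eseriesr => n _; rewrite -EFinM -normrM.
Qed.

Lemma ell1_submod_closed : submod_closed ell1_pred.
Proof.
split.
  apply/mem_set; rewrite /ell1_set/=.
  have -> : 0 = 0 *: (0 : nat -> R) by rewrite scaler0.
  by rewrite ell1_normZ normr0 mul0e.
move=> a x y /set_mem/= xX /set_mem/= yX; apply/mem_set.
rewrite /ell1_set/=; apply: le_lt_trans (ell1_normD _ _) _.
apply: lte_add_pinfty => //; rewrite ell1_normZ.
by apply: lte_mul_pinfty => //; rewrite lee_fin.
Qed.

HB.instance Definition _ :=
  GRing.isSubmodClosed.Build _ _ ell1_pred ell1_submod_closed.
HB.instance Definition _ := [SubChoice_isSubLmodule of ell1 by <:].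

Let nrm (x : ell1) : R := fine (ell1_norm x).

Let nrmE (x : ell1) : (nrm x)%:E = ell1_norm x.
Proof.
rewrite /nrm fineK// ge0_fin_numE ?ell1_norm_ge0//.
exact: (set_mem (ell1_valP x)).
Qed.

Let nrmD (x y : ell1) : nrm (x + y) <= nrm x + nrm y.
Proof. by rewrite -lee_fin EFinD !nrmE; exact: ell1_normD. Qed.

Let nrmZ a (x : ell1) : nrm (a *: x) = `|a| * nrm x.
Proof. by apply: EFin_inj; rewrite EFinM !nrmE; exact: ell1_normZ. Qed.

Let nrm0_eq0 (x : ell1) : nrm x = 0 -> x = 0.
Proof.
move=> x0; apply/val_inj/funext => i.
suff /eqP : x i == 0 by [].
rewrite -normr_le0 -lee_fin -x0 nrmE; exact: ell1_norm_coord.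
Qed.

HB.instance Definition _ := Lmodule_isNormed.Build R ell1 nrmD nrmZ nrm0_eq0.

Lemma ell1_normE (x : ell1) : `|x| = fine (ell1_norm x).
Proof. by []. Qed.

End ell1.

Section c0_sum.
Context (R : realType) (E : normedModType R).
Implicit Types x y : nat -> E.

Definition c0_sum_set : set (nat -> E) :=
  [set x : nat -> E | `|x n| @[n --> \oo] --> (0 : R)].

Definition c0_sum_pred : {pred nat -> E} := mem c0_sum_set.

Record c0_sum := C0Sum {
  c0_sum_val :> nat -> E;
  c0_sum_valP : c0_sum_val \in c0_sum_pred }.

HB.instance Definition _ := [isSub for c0_sum_val].
HB.instance Definition _ := [Choice of c0_sum by <:].

Lemma c0_sum_submod_closed : submod_closed c0_sum_pred.
Proof.
split.
  apply/mem_set; rewrite /c0_sum_set/=.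
  by under eq_cvg do rewrite normr0; exact: cvg_cst.
move=> a x y /set_mem/= xX /set_mem/= yX; apply/mem_set.
apply/(norm_cvg0P (a *: x + y)).
have -> : 0 = a *: 0 + 0 :> E by rewrite scaler0 addr0.
by apply: cvgD; [apply: cvgZl_tmp|]; apply/norm_cvg0P.
Qed.

HB.instance Definition _ :=
  GRing.isSubmodClosed.Build _ _ c0_sum_pred c0_sum_submod_closed.
HB.instance Definition _ := [SubChoice_isSubLmodule of c0_sum by <:].

Definition c0_sum_norm x : R := sup (range (fun n => `|x n|)).

Lemma c0_sum_has_ubound (x : c0_sum) : has_ubound (range (fun n => `|x n|)).
Proof.
have /set_mem xX := c0_sum_valP x.
have /cvg_seq_bounded/ex_bound : cvgn (fun n => `|x n|).
  by apply/cvg_ex; exists 0.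
move=> /(_ _)[|M xM]; first by apply: (@globally_properfilter _ _ 0%N).
exists M => _ [n _ <-].
by have := xM n I; rewrite /= normr_id.
Qed.

Let nrm (x : c0_sum) : R := c0_sum_norm x.

Let nrm_ub (x : c0_sum) n : `|x n| <= nrm x.
Proof. by apply: ub_le_sup; [exact: c0_sum_has_ubound|exists n]. Qed.

Let nrm_le (x : c0_sum) M : (forall n, `|x n| <= M) -> nrm x <= M.
Proof.
move=> xM; apply: ge_sup; first by exists `|x 0%N|; exists 0%N.
by move=> _ [n _ <-].
Qed.

Let nrmD (x y : c0_sum) : nrm (x + y) <= nrm x + nrm y.
Proof. by apply: nrm_le => n; rewrite (le_trans (ler_normD _ _))// lerD. Qed.

Let nrmZ_le a (x : c0_sum) : nrm (a *: x) <= `|a| * nrm x.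
Proof. by apply: nrm_le => n; rewrite normrZ ler_wpM2l. Qed.

Let nrmZ a (x : c0_sum) : nrm (a *: x) = `|a| * nrm x.
Proof.
apply/eqP; rewrite eq_le nrmZ_le/=.
have [->|a0] := eqVneq a 0.
  by rewrite normr0 mul0r (le_trans (normr_ge0 _) (nrm_ub _ 0%N)).
rewrite -ler_pdivlMl ?normr_gt0// -normfV.
by rewrite -{1}(scalerK a0 x) nrmZ_le.
Qed.

Let nrm0_eq0 (x : c0_sum) : nrm x = 0 -> x = 0.
Proof.
move=> x0; apply/val_inj/funext => i.
suff /eqP : x i == 0 by [].
by rewrite -normr_le0 -x0 nrm_ub.
Qed.

HB.instance Definition _ := Lmodule_isNormed.Build R c0_sum nrmD nrmZ nrm0_eq0.

Lemma c0_sum_normE (x : c0_sum) : `|x| = sup (range (fun n => `|x n|)).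
Proof. by []. Qed.

End c0_sum.

Section isomorphic.
Context (R : realType) (E X : normedModType R).

Definition closed_subspace (Y : set X) : Prop :=
  submod_closed (mem Y) /\ closed Y.

(* [S], which only matters on [Y], is the inverse of [T]; [Y] carries the
   topology induced by [X]. *)
Definition isomorphic_to_subspace (Y : set X) : Prop :=
  exists (T : {linear E -> X}) (S : X -> E),
    [/\ continuous T, set_bij [set: E] Y T,
        cancel T S & {within Y, continuous S}].

End isomorphic.
Arguments isomorphic_to_subspace {R} E {X} Y.

(* Main.v *)
(* Write mass w F for the sum of |w(i)| over F, chains being the sets on which f
   is increasing, and suppose T embeds c_0(l_1) into X_f.

   In the n-th copy of l_1, linear algebra gives disjointly supported unit
   vectors whose images under T vanish on longer and longer initial segments.
   The vectors of norm 1 with the signs of these form a convex set, and its image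
   W_n is bounded away from 0.  A Ptak-type averaging argument then produces
   vectors v_{n,j} in W_n and finite chains G_{n,0}, G_{n,1}, ..., each lying
   above the previous ones both in index and in f-value, such that the mass of
   v_{n,j} on G_{n,j} is at least d, with d independent of n and j.

   Let t_n = sup f over the union of the G_{n,j}.  Handling the n < N by
   increasing t_n, one can stack one chain G_{n,j(n)} for each n into a single
   chain.  With suitable signs, the sum of the +-v_{n,j(n)} has mass at least N d
   on it, although it is the image of a vector of norm at most 1 in c_0(l_1). *)
Require Import Defs.
From HB Require Import structures.
From mathcomp Require Import all_boot all_order all_algebra finmap.
From mathcomp Require Import all_classical all_reals all_analysis.
From mathcomp Require Import lra.
Set Implicit Arguments.
Unset Strict Implicit.
Unset Printing Implicit Defensive.
Import Order.TTheory GRing.Theory Num.Theory.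
Import numFieldNormedType.Exports.
Local Open Scope classical_set_scope.
Local Open Scope ring_scope.

(** * Masses on finite sets *)

Section mass.
Context {R : realType}.
Implicit Types (u v w : nat -> R) (F G : {fset nat}).

Definition mass w F : R := \sum_(i <- F) `|w i|.

Lemma mass_ge0 w F : 0 <= mass w F.
Proof. exact: sumr_ge0. Qed.

Lemma massD u v F : mass (u + v) F <= mass u F + mass v F.
Proof.
by rewrite -big_split/=; apply: ler_sum => i _; exact: ler_normD.
Qed.

Lemma massZ a w F : mass (a *: w) F = `|a| * mass w F.
Proof. by rewrite mulr_sumr; apply: eq_bigr => i _; rewrite -normrM. Qed.

Lemma mass_convex a u v F : 0 <= a <= 1 ->
  mass (a *: u + (1 - a) *: v) F <= a * mass u F + (1 - a) * mass v F.
Proof.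
move=> /andP[a0 a1]; apply: le_trans (massD _ _ _) _.
by rewrite !massZ !ger0_norm ?subr_ge0.
Qed.

Lemma mass_split w F (P : pred nat) :
  mass w F =
  mass w [fset i in F | P i]%fset + mass w [fset i in F | ~~ P i]%fset.
Proof. exact: big_fsetID. Qed.

Lemma mass_eq0 w F : (forall i, i \in F -> w i = 0) -> mass w F = 0.
Proof.
by move=> w0; rewrite /mass big_seq big1// => i /w0 ->; rewrite normr0.
Qed.

Lemma massU w F G : (forall i, i \in F -> i \notin G) ->
  mass w (F `|` G)%fset = mass w F + mass w G.
Proof.
move=> FG; rewrite (mass_split _ _ (mem F)); congr (mass w _ + mass w _).
  by apply/fsetP => i; rewrite !inE andb_orl andbb; case: (i \in F); rewrite ?andbF.
apply/fsetP => i; rewrite !inE.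
by have [/FG/negPf ->|_] := boolP (i \in F); rewrite ?andbF ?andbT.
Qed.

(* The average over the two signs of [`|a + b|] and [`|a - b|] dominates both
   [`|a|] and [`|b|]. *)
Lemma exists_sign_mass u v F G : (forall i, i \in F -> i \notin G) ->
  exists2 s : R, `|s| = 1 &
    mass u F + mass v G <= mass (u + s *: v) (F `|` G)%fset.
Proof.
move=> FG.
have H : 2 * (mass u F + mass v G) <=
    mass (u + 1 *: v) (F `|` G)%fset + mass (u + (-1) *: v) (F `|` G)%fset.
  have avg (a b : R) : 2 * `|a| <= `|a + b| + `|a - b|.
    apply: le_trans (ler_normD _ _).
    by rewrite (_ : a + b + (a - b) = 2 * a) ?normrM ?normr_nat//; lra.
  rewrite !massU// mulrDr addrACA lerD// -big_split mulr_sumr ler_sum// => i _ /=.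
    by apply: le_trans (avg _ (v i)) _; rewrite !fctE scale1r scaleN1r.
  apply: le_trans (avg _ (u i)) _; rewrite !fctE scale1r scaleN1r.
  by rewrite (addrC (v i) (u i)) (distrC (v i)).
have [le1|/ltW le2] := leP (mass u F + mass v G) (mass (u + 1 *: v) (F `|` G)%fset).
  by exists 1; rewrite ?normr1.
exists (-1); first by rewrite normrN1.
lra.
Qed.

End mass.

(** * Ptak-type averaging and the extraction of blocks *)

Section extraction.
Context {R : realType} (f : nat -> rat).
Implicit Types (w : nat -> R) (F G : {fset nat}) (U : set nat).
Implicit Types W : set (nat -> R).

Definition chain_in U F := increasing_sets f F /\ forall i, i \in F -> U i.

(** A chain inside [above G U] can be appended to the chain [G]: this is the room left for later
    blocks. *)
Definition above G U : set nat :=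
  U `&` [set i | forall g, g \in G -> (g < i)%N /\ f g < f i].

Definition mass_le e U w := forall F, chain_in U F -> mass w F <= e.

(** Convexity permits averaging; deep vectors let each choice start beyond the significant part of
    the earlier ones. *)
Definition rich W :=
  (forall (a : R) u v, 0 <= a <= 1 -> W u -> W v -> W (a *: u + (1 - a) *: v))
  /\ forall M, exists2 w, W w & forall i, (i < M)%N -> w i = 0.

Definition uniformly_large e U W :=
  forall w, W w -> exists2 F, chain_in U F & e <= mass w F.

Lemma chain_in_filter U F (P : pred nat) :
  chain_in U F -> chain_in U [fset i in F | P i]%fset.
Proof.
move=> [Fi FU]; split; last by move=> i; rewrite !inE => /andP[/FU].
by move=> n k; rewrite !inE => /andP[nF _] /andP[kF _]; exact: Fi.
Qed.

Lemma rich_vanishing W M :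
  rich W -> rich (W `&` [set w | forall i, (i < M)%N -> w i = 0]).
Proof.
move=> [Wc Wd]; split.
  move=> a u v a01 [Wu u0] [Wv v0]; split; first exact: Wc.
  by move=> i iM; rewrite !fctE u0// v0// !scaler0 addr0.
move=> M'; have [w Ww w0] := Wd (maxn M M'); exists w.
  by split=> // i iM; apply: w0; rewrite leq_max iM.
by move=> i iM; apply: w0; rewrite leq_max iM orbT.
Qed.

(** Convexity is inherited because mass is convex. For the other half, the hypothesis is applied to
    the vectors of [W] vanishing below [M], hence its quantification over rich subsets. *)
Lemma rich_mass_le W e U : rich W ->
  (forall W', W' `<=` W -> rich W' -> exists2 w, W' w & mass_le e U w) ->
  rich (W `&` mass_le e U).
Proof.
move=> Wr H; split.
  move=> a u v /[dup] a01 /andP[a0 a1] [Wu ue] [Wv ve]; split.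
    exact: Wr.1.
  move=> F FU; apply: le_trans (mass_convex _ _ _ a01) _.
  have := ler_wpM2l a0 (ue F FU).
  have := ler_wpM2l (_ : 0 <= 1 - a) (ve F FU).
  by rewrite subr_ge0 => /(_ a1); lra.
move=> M; have [w [Ww w0] we] := H _ (@subIsetl _ W _) (rich_vanishing M Wr).
by exists w.
Qed.

Lemma rich_mass_le_seq W e U (Gs : seq {fset nat}) : rich W ->
  (forall W' G, W' `<=` W -> rich W' -> G \in Gs ->
    exists2 w, W' w & mass_le e (above G U) w) ->
  exists2 W', W' `<=` W /\ rich W' &
    forall w G, W' w -> G \in Gs -> mass_le e (above G U) w.
Proof.
move=> Wr; elim: Gs => [_|G Gs IH H]; first by exists W; [split|].
have [|W1 [W1W W1r] W1Gs] := IH.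
  by move=> W1 G1 W1W W1r G1Gs; apply: H => //; rewrite inE G1Gs orbT.
exists (W1 `&` mass_le e (above G U)).
  split; first exact: subset_trans (@subIsetl _ _ _) W1W.
  apply: rich_mass_le => // W2 W2W1 W2r.
  by apply: H; [exact: subset_trans W1W|by []|rewrite inE eqxx].
move=> w G' [W1w wG]; rewrite inE => /predU1P[->//|G'Gs].
exact: W1Gs.
Qed.

Variables (C : R) (W0 : set (nat -> R)).
Hypothesis mass_leC : forall w F, W0 w -> increasing_sets f F -> mass w F <= C.
Hypothesis small_tail : forall w e, W0 w -> 0 < e -> exists N, forall F,
  increasing_sets f F -> (forall i, i \in F -> (N <= i)%N) -> mass w F <= e.

(* If no step from [W] were possible, one could pick [w_1, ..., w_r] in turn so
   that a chain charging [w_i] charges every later vector by at most [e]; the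
   average of the [w_i] then has small norm. *)
Lemma small_average W U d e r : 0 <= d < e -> rich W -> W `<=` W0 ->
  (forall W' G w, W' `<=` W -> rich W' -> W w -> chain_in U G ->
    d <= mass w G -> exists2 w', W' w' & mass_le e (above G U) w') ->
  exists2 w, W w & forall F, chain_in U F -> r%:R * mass w F <= r%:R * e + C.
Proof.
move=> /andP[d0 de]; elim: r W => [|r IH] W Wr WW0 H.
  have [w Ww _] := Wr.2 0%N; exists w => // F FU; rewrite !mul0r add0r.
  exact: le_trans (mass_ge0 w F) (mass_leC (WW0 _ Ww) FU.1).
have [v Wv _] := Wr.2 0%N.
(* A chain whose part below [N] has [v]-mass less than [d] then has total [v]-mass less than [e];
   the other possible parts form the finite list [Gs]. *)
have [|N vN] := small_tail (WW0 _ Wv) (_ : 0 < e - d); first by rewrite subr_gt0.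
pose Gs : seq {fset nat} := [seq G <- enum_fset (fpowerset [fset i in iota 0 N]%fset)
  | `[< chain_in U G /\ d <= mass v G >]].
have [W1 G W1W W1r|W1 [W1W W1r] W1Gs] := @rich_mass_le_seq W e U Gs Wr.
  by rewrite mem_filter => /andP[/asboolP[GU dG] _]; exact: (H _ _ v).
have W2r := rich_vanishing N W1r.
set W2 := (X in rich X) in W2r.
have W2W : W2 `<=` W by apply: subset_trans W1W; exact: subIsetl.
have [|W' G w W'W2 W'r /W2W Ww|w W2w wF] := IH W2 W2r.
- exact: subset_trans WW0.
- by apply: H => //; exact: subset_trans W2W.
(* With this weight, [r + 1] times the new average is [v + r w]. *)
pose a : R := r.+1%:R^-1.
have r0 : 0 < r.+1%:R :> R by rewrite ltr0n.
have a01 : 0 <= a <= 1 by rewrite invr_ge0 (ltW r0) invf_le1// ler1n.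
have ra : r.+1%:R * a = 1 by rewrite /a divff// gt_eqF.
have rE : r.+1%:R = 1 + r%:R :> R by rewrite -natr1 addrC.
exists (a *: v + (1 - a) *: w); first by apply: Wr.1 => //; exact: W2W.
move=> F FU; have := ler_wpM2l (ltW r0) (mass_convex v w F a01).
rewrite mulrDr !mulrA mulrBr ra mulr1 mul1r rE addrAC subrr add0r => /le_trans; apply.
rewrite mulrDl mul1r.
pose G := [fset i in F | (i < N)%N]%fset.
have GU : chain_in U G by exact: chain_in_filter.
have vG : mass v F <= mass v G + (e - d).
  rewrite (mass_split v F (fun i => (i < N)%N)) lerD2l.
  apply: vN; first by case: (chain_in_filter (fun i => ~~ (i < N)%N) FU).
  by move=> i; rewrite !inE -leqNgt => /andP[].
(* Light initial part: [v] costs at most [e] and induction handles [w]. Heavy one: [v] costs at most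
   [C], but [w] at most [e], since it vanishes on [G] and the rest of [F] lies above [G]. *)
have [dG|Gd] := leP d (mass v G); last first.
  by have := wF F FU; lra.
suff : mass w F <= e.
  have r0' : 0 <= r%:R :> R by [].
  move=> /(ler_wpM2l r0'); have := mass_leC (WW0 _ Wv) FU.1.
  lra.
rewrite (mass_split w F (fun i => (i < N)%N)) mass_eq0 ?add0r; last first.
  by move=> i; rewrite !inE => /andP[_ iN]; apply: W2w.2.
apply: (W1Gs w G W2w.1).
  rewrite mem_filter; apply/andP; split; first exact/asboolP.
  rewrite fpowersetE; apply/fsubsetP => i; rewrite !inE mem_iota add0n.
  by case/andP.
split; first by case: (chain_in_filter (fun i => ~~ (i < N)%N) FU).
move=> i; rewrite !inE -leqNgt => /andP[iF Ni]; split; first exact: FU.2.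
move=> g; rewrite !inE => /andP[gF gN]; have gi := leq_trans gN Ni.
by split=> //; apply: FU.1.
Qed.

(** Otherwise [small_average], used midway between [d] and [e], yields a vector of mass below [e] on
    every chain in [U]. The new threshold still exceeds [d], so extraction can be repeated with the
    same [d]. *)
Lemma exists_block W U d e : 0 <= d < e -> rich W -> W `<=` W0 ->
  uniformly_large e U W ->
  exists v G W', [/\ W0 v, chain_in U G & d <= mass v G] /\
    [/\ W' `<=` W, rich W' &
      exists2 e', d < e' & uniformly_large e' (above G U) W'].
Proof.
move=> /andP[d0 de] Wr WW0 We; apply: contrapT => N.
pose e' := (d + e) / 2.
have de' : d < e' by rewrite /e'; lra.
have ee' : 0 < e - e' by rewrite /e'; lra.
have H W' G w : W' `<=` W -> rich W' -> W w -> chain_in U G ->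
    d <= mass w G -> exists2 w', W' w' & mass_le e' (above G U) w'.
  move=> W'W W'r Ww GU dG; apply: contrapT => N'; apply: N.
  exists w, G, W'; split; split=> //; first exact: WW0.
  exists e' => // w' W'w'; apply: contrapT => NF; apply: N'.
  exists w' => // F FU; rewrite leNgt; apply/negP => /ltW eF.
  by apply: NF; exists F.
(* Large enough that [r e' + C < r e]. *)
pose r := (Num.truncn (C / (e - e'))).+1.
have [|w Ww wF] := @small_average W U d e' r _ Wr WW0 H; first exact/andP.
have [F FU eF] := We w Ww.
have := wF F FU; apply/negP; rewrite -ltNge.
have : C < r%:R * (e - e') by rewrite -ltr_pdivrMr// truncnS_gt.
have r0 : 0 <= r%:R :> R by [].
by have := ler_wpM2l r0 eF; lra.
Qed.

Lemma exists_block_sequence d e : 0 <= d < e -> rich W0 ->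
  uniformly_large e setT W0 ->
  exists (v : nat -> nat -> R) (G : nat -> {fset nat}),
    (forall j, [/\ W0 (v j), increasing_sets f (G j) & d <= mass (v j) (G j)]) /\
    forall j k g h, (j < k)%N -> g \in G j -> h \in G k -> (g < h)%N /\ f g < f h.
Proof.
move=> /andP[d0 de] W0r W0e.
pose good (x : set (nat -> R) * set nat) := [/\ x.1 `<=` W0, rich x.1 &
  exists2 e', d < e' & uniformly_large e' x.2 x.1].
pose block (x y : set (nat -> R) * set nat) (p : (nat -> R) * {fset nat}) :=
  [/\ W0 p.1, chain_in x.2 p.2, d <= mass p.1 p.2 & y.2 = above p.2 x.2].
have next (x : {x | good x}) : {y : {y | good y} | exists p, block (sval x) (sval y) p}.
  case: x => -[W U] /= gx; apply: cid.
  have [/= WW0 Wr [e' de' We']] := gx.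
  have de'2 : 0 <= d < e' by exact/andP.
  have [v [G [W' [[W0v GU dG] [W'W W'r W'e]]]]] := exists_block de'2 Wr WW0 We'.
  have gy : good (W', above G U) by split=> //; exact: subset_trans WW0.
  by exists (exist _ _ gy), (v, G).
have g0 : good (W0, setT) by split=> //; exists e.
have [s [s0 /choice[p sp]]] := dependent_choice next (exist _ _ g0).
exists (fun j => (p j).1), (fun j => (p j).2); split.
  by move=> j; have [] := sp j => ? [].
move=> j k g h jk gj hk.
suff : (sval (s j.+1)).2 h.
  by have [_ _ _ ->] := sp j; case=> _; apply.
(* The regions shrink, so every later block lies in the region above block [j]. *)
have U_anti m i : (sval (s (m + i)%N)).2 `<=` (sval (s i)).2.
  elim: m => [|m IH] //; apply: subset_trans IH.
  by rewrite addSn; have [_ _ _ ->] := sp (m + i)%N; exact: subIsetl.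
rewrite -(subnK jk) in hk; apply: (U_anti (k - j.+1)%N).
by have [_ [_ +] _ _] := sp (k - j.+1 + j.+1)%N; apply.
Qed.

End extraction.

(** * Stacking one block from each sequence into a single chain *)

Section gluing.
Context {R : realType} (f : nat -> rat) (d : R).
Hypothesis d_gt0 : 0 < d.
Variables (v : nat -> nat -> nat -> R) (G : nat -> nat -> {fset nat}).
Hypothesis G_chain : forall n j, increasing_sets f (G n j).
Hypothesis vG : forall n j, d <= mass (v n j) (G n j).
Hypothesis G_lt : forall n j k g h, (j < k)%N -> g \in G n j -> h \in G n k ->
  (g < h)%N /\ f g < f h.

(* [t_n], the supremum of the rationals met by the [n]-th sequence of blocks. *)
Let level n : \bar R :=
  ereal_sup [set (ratr (f g))%:E | g in [set g | exists j, g \in G n j]].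

Let G_neq0 n j : exists g, g \in G n j.
Proof.
apply/fset0Pn/eqP => G0; have := vG n j.
by rewrite G0 /mass big_seq_fset0 leNgt d_gt0.
Qed.

Let G_ge n j g : g \in G n j -> (j <= g)%N.
Proof.
elim: j g => // j IH g gG; have [h hG] := G_neq0 n j.
by apply: leq_ltn_trans (IH _ hG) _; case: (G_lt (ltnSn j) hG gG).
Qed.

Let G_lt_level n j g : g \in G n j -> ((ratr (f g))%:E < level n)%E.
Proof.
move=> gG; have [h hG] := G_neq0 n j.+1.
apply: (@lt_le_trans _ _ (ratr (f h))%:E).
  by rewrite lte_fin ltr_rat; case: (G_lt (ltnSn j) gG hG).
by apply: ereal_sup_ubound; exists h => //; exists j.+1.
Qed.

(** The supremum supplies a block element with [f]-value beyond [f i], and later blocks are higher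
    still; [G_ge] pushes their indices past [i]. *)
Let eventually_above n (s : seq nat) :
  (forall i, i \in s -> ((ratr (f i))%:E < level n)%E) ->
  exists K, forall k i h, (K <= k)%N -> i \in s -> h \in G n k ->
    (i < h)%N /\ f i < f h.
Proof.
elim: s => [_|i s IH H]; first by exists 0%N.
have [|K HK] := IH; first by move=> i' i's; apply: H; rewrite inE i's orbT.
have [_ [g [j gG] <-]] := ereal_sup_gt (H i (mem_head _ _)).
rewrite lte_fin ltr_rat => ig.
exists (maxn K (maxn i.+1 j.+1)) => k i' h; rewrite !geq_max => /and3P[Kk ik jk].
rewrite inE => /predU1P[->|i's] hG; last exact: HK Kk i's hG.
split; first exact: leq_trans ik (G_ge hG).
by apply: lt_trans ig _; case: (G_lt jk gG hG).
Qed.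

(* The list is in decreasing order of [t_n], so the chain is built from the tail:
   everything below some earlier [t_m] is also below [t_n]. *)
Let glue_sorted (s : seq nat) : uniq s ->
  sorted (fun n m => (level m <= level n)%E) s ->
  exists (a : nat -> R) (j : nat -> nat) (F : {fset nat}),
  [/\ forall n, `|a n| = 1, increasing_sets f F,
      forall i, i \in F -> exists2 n, n \in s & ((ratr (f i))%:E < level n)%E &
      (size s)%:R * d <= mass (\sum_(n <- s) a n *: v n (j n)) F].
Proof.
elim: s => [_ _|n s IH /= /andP[ns us] nss].
  exists (fun=> 1), (fun=> 0%N), fset0; split=> //.
  - by move=> n; rewrite normr1.
  - by rewrite mul0r mass_ge0.
have [a [j [F [a1 Fc Fs sF]]]] := IH us (path_sorted nss).
have le_n m : m \in s -> (level m <= level n)%E.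
  have /allP : all (fun m => (level m <= level n)%E) s.
    by apply: order_path_min nss => x y z /[swap]; exact: le_trans.
  by apply.
(* Each element of [F] is below some [level m], hence below [level n], so a late block [G n K] fits
   on top. *)
have [|K HK] := @eventually_above n (enum_fset F).
  by move=> i /Fs[m /le_n]; move=> /[swap]; exact: lt_le_trans.
have FG i : i \in F -> i \notin G n K.
  by move=> iF; apply/negP => /(HK _ _ _ (leqnn K) iF)[]; rewrite ltnn.
have [e e1 le_mass] :=
  exists_sign_mass (\sum_(m <- s) a m *: v m (j m)) (v n K) FG.
exists (fun m => if m == n then e else a m), (fun m => if m == n then K else j m).
exists (F `|` G n K)%fset; split.
- by move=> m; case: ifP.
- move=> x y; rewrite !inE => /orP[xF|xG] /orP[yF|yG] xy.
  + exact: Fc.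
  + by case: (HK _ _ _ (leqnn K) xF yG).
  + by case: (HK _ _ _ (leqnn K) yF xG) => /(ltn_trans xy); rewrite ltnn.
  + exact: (G_chain xG yG).
- move=> i; rewrite !inE => /orP[/Fs[m ms im]|iG].
    by exists m => //; rewrite inE ms orbT.
  by exists n; rewrite ?mem_head ?(G_lt_level iG).
- rewrite big_cons eqxx addrC -natr1 mulrDl mul1r.
  apply: le_trans (lerD sF (vG n K)) _; apply: le_trans le_mass _.
  (* As [n] is not in [s], overriding the sign and block at [n] leaves the sum over [s]
     unchanged. *)
  rewrite le_eqVlt; apply/orP; left; apply/eqP; congr (mass (_ + _) _).
  apply: eq_big_seq => m ms; case: eqP => // mn.
  by move: ns; rewrite -mn ms.
Qed.

Lemma glue_blocks (s : seq nat) : uniq s ->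
  exists (a : nat -> R) (j : nat -> nat) (F : {fset nat}),
  [/\ forall n, `|a n| = 1, increasing_sets f F &
      (size s)%:R * d <= mass (\sum_(n <- s) a n *: v n (j n)) F].
Proof.
move=> us; pose r n m := (level m <= level n)%E.
have r_total : total r by move=> n m; exact: le_total.
have [||a [j [F [a1 Fc _]]]] := @glue_sorted (sort r s).
- by rewrite sort_uniq.
- exact: sort_sorted.
rewrite size_sort (perm_big s) ?perm_sort//= => sF.
by exists a, j, F.
Qed.

End gluing.

(** * Copies of a space inside its [c_0]-sum *)

Section c0_sum_single.
Context {R : realType} {E : normedModType R}.

Let single_subproof n (y : E) :
  (fun m => if m == n then y else 0) \in @c0_sum_pred R E.
Proof.
apply/mem_set; apply: cvg_near_cst; exists n.+1 => // m /= nm.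
by rewrite gtn_eqF// normr0.
Qed.

Definition c0_single n (y : E) : c0_sum E := C0Sum (single_subproof n y).

Let c0_single_linear n : linear (c0_single n).
Proof.
move=> a x y; apply/val_inj/funext => m.
change ((if m == n then a *: x + y else 0) =
  a *: (if m == n then x else 0) + (if m == n then y else 0)).
by case: ifP => // _; rewrite scaler0 addr0.
Qed.

HB.instance Definition _ n :=
  GRing.isLinear.Build R E (c0_sum E) *:%R (c0_single n) (@c0_single_linear n).

Lemma c0_sum_norm_ge (x : c0_sum E) n : `|x n| <= `|x|.
Proof. by rewrite c0_sum_normE; apply: ub_le_sup; [exact: c0_sum_has_ubound|exists n]. Qed.

Lemma c0_sum_norm_le (x : c0_sum E) (M : R) : (forall n, `|x n| <= M) -> `|x| <= M.
Proof.
move=> xM; rewrite c0_sum_normE; apply: ge_sup; first by exists `|x 0%N|; exists 0%N.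
by move=> _ [n _ <-].
Qed.

Lemma c0_single_norm n (y : E) : `|c0_single n y| = `|y|.
Proof.
apply/eqP; rewrite eq_le; apply/andP; split.
  by apply: c0_sum_norm_le => m /=; case: ifP; rewrite ?normr0.
by have := c0_sum_norm_ge (c0_single n y) n; rewrite /= eqxx.
Qed.

(** Each coordinate sees at most one term, so the bound does not grow with the length of [s]; the
    stacked chain will contradict this. *)
Lemma c0_single_sum_norm_le (s : seq nat) (y : nat -> E) (M : R) :
  uniq s -> 0 <= M -> (forall n, `|y n| <= M) ->
  `|\sum_(n <- s) c0_single n (y n)| <= M.
Proof.
move=> us M0 yM; apply: c0_sum_norm_le => m.
have -> : (\sum_(n <- s) c0_single n (y n) : c0_sum E) m =
    \sum_(n <- s) (if m == n then y n else 0).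
  transitivity ((val (\sum_(n <- s) c0_single n (y n) : c0_sum E)) m) => //.
  by rewrite raddf_sum fct_sumE.
have [ms|ms] := boolP (m \in s).
  rewrite (bigD1_seq m)//= eqxx big1 ?addr0// => n /negPf.
  by rewrite eq_sym => ->.
by rewrite big_seq big1 ?normr0// => n ns; case: eqP => // mn; rewrite -mn (negPf ms) in ns.
Qed.

End c0_sum_single.

(** * Unit vectors of [l_1] with prescribed signs *)

Section ell1_cone.
Context {R : realType}.

Let unit_subproof k : (fun i => (i == k)%:R : R) \in @ell1_pred R.
Proof.
apply/mem_set; rewrite /ell1_set/= /ell1_norm.
rewrite (nneseries_split 0 k.+1)//.
rewrite add0n eseries0 ?adde0; last first.
  by move=> i ki _; rewrite gtn_eqF// normr0.
by rewrite sumEFin ltry.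
Qed.

Definition ell1_unit k : ell1 R := Ell1 (unit_subproof k).

Lemma ell1_unit_sumE (n : nat) (a : nat -> R) (p : nat -> nat) i :
  (\sum_(k < n) a k *: ell1_unit (p k) : ell1 R) i =
  \sum_(k < n) a k * (i == p k)%:R.
Proof.
transitivity ((val (\sum_(k < n) a k *: ell1_unit (p k) : ell1 R)) i) => //.
by rewrite raddf_sum fct_sumE.
Qed.

Lemma ell1_norm_fin (x : ell1 R) : (`|x|%:E = ell1_norm x)%E.
Proof.
rewrite ell1_normE fineK// ge0_fin_numE ?ell1_norm_ge0//.
exact: (set_mem (ell1_valP x)).
Qed.

Lemma ell1_normD_eq (x y : ell1 R) :
  (forall i, `|x i + y i| = `|x i| + `|y i|) -> `|x + y| = `|x| + `|y|.
Proof.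
move=> xy; apply: EFin_inj; rewrite EFinD !ell1_norm_fin /ell1_norm.
rewrite -nneseriesD; [|by move=> *; rewrite lee_fin..].
by apply: eq_eseriesr => i _; rewrite -EFinD -xy.
Qed.

(** Letting [r] vary with [i] prescribes only signs, not sizes. *)
Definition ell1_ray_norm1 (h : nat -> R) : set (ell1 R) :=
  [set y : ell1 R | `|y| = 1 /\ forall i, exists2 r, 0 <= r & y i = r * h i].

(** Equal signs exclude cancellation, so the [l_1] norm is additive here. *)
Lemma ell1_ray_norm1_convex h (a : R) x y : 0 <= a <= 1 ->
  ell1_ray_norm1 h x -> ell1_ray_norm1 h y ->
  ell1_ray_norm1 h (a *: x + (1 - a) *: y).
Proof.
move=> /andP[a0 a1] [x1 xh] [y1 yh]; rewrite -subr_ge0 in a1.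
have H i : exists r s, [/\ 0 <= r, 0 <= s, (a *: x) i = r * h i &
    ((1 - a) *: y) i = s * h i].
  have [r r0 xr] := xh i; have [s s0 ys] := yh i.
  exists (a * r), ((1 - a) * s); rewrite !mulr_ge0//; split=> //.
    by rewrite -mulrA -xr.
  by rewrite -mulrA -ys.
split.
  rewrite ell1_normD_eq ?normrZ ?x1 ?y1 ?ger0_norm//; first by rewrite !mulr1; lra.
  move=> i; have [r [s [r0 s0 -> ->]]] := H i.
  by rewrite -mulrDl !normrM (ger0_norm r0) (ger0_norm s0)
    (ger0_norm (addr_ge0 r0 s0)) mulrDl.
move=> i; have [r [s [r0 s0 xr ys]]] := H i.
exists (r + s); first exact: addr_ge0.
transitivity ((a *: x) i + ((1 - a) *: y) i) => //.
by rewrite xr ys mulrDl.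
Qed.

(** There are [M + 1] vectors but only [M] linear conditions, so the matrix of coordinates has a
    nonzero left kernel. *)
Lemma exists_vanishing_comb (U : lmodType R) (phi : {linear U -> (nat -> R)})
    (x : nat -> U) (M : nat) :
  exists2 a : nat -> R, (exists2 k, (k < M.+1)%N & a k != 0) &
    forall i, (i < M)%N -> phi (\sum_(k < M.+1) a k *: x k) i = 0.
Proof.
pose A : 'M[R]_(M.+1, M) := \matrix_(k, i) phi (x k) i.
pose w := nz_row (kermx A).
have w0 : w != 0.
  rewrite nz_row_eq0 -mxrank_eq0 mxrank_ker subn_eq0 -ltnNge ltnS.
  exact: rank_leq_col.
have wA : w *m A = 0 by apply/sub_kermxP; exact: nz_row_sub.
exists (fun k => w 0 (inord k)).
  have [k wk] := rV0Pn _ w0.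
  by exists k => //; rewrite inord_val.
move=> i iM; have := congr1 (fun B : 'rV[R]_M => B 0 (Ordinal iM)) wA.
rewrite !mxE => <-; rewrite linear_sum fct_sumE; apply: eq_bigr => k _ /=.
by rewrite linearZ_LR !mxE inord_val.
Qed.

(* The vectors chosen for the various [M] have disjoint supports (through
   [pickle]), so that a single [h] records all their signs. *)
Lemma ell1_ray_norm1_deep (phi : {linear ell1 R -> (nat -> R)}) :
  exists h, forall M, exists2 y, ell1_ray_norm1 h y &
    forall i, (i < M)%N -> phi y i = 0.
Proof.
pose p (M k : nat) : nat := choice.pickle (M, k).
have p_inj M : injective (p M) by move=> k l /(pcan_inj (@choice.pickleK _))[].
have /choice[a aP] M : exists a : nat -> R, (exists2 k, (k < M.+1)%N & a k != 0) /\
    forall i, (i < M)%N -> phi (\sum_(k < M.+1) a k *: ell1_unit (p M k)) i = 0.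
  by have [a a0 a1] := exists_vanishing_comb phi (ell1_unit \o p M) M; exists a.
exists (fun j => if choice.unpickle j is Some q then a q.1 q.2 else 0) => M.
have [[k kM ak] phi0] := aP M.
pose w : ell1 R := \sum_(k < M.+1) a M k *: ell1_unit (p M k).
have wp l : (l < M.+1)%N -> w (p M l) = a M l.
  move=> lM; rewrite /w ell1_unit_sumE (bigD1 (Ordinal lM))//= eqxx mulr1.
  rewrite big1 ?addr0// => m /negPf ml.
  by rewrite (inj_eq (@p_inj M)) eq_sym (_ : (m == l :> nat) = false) ?mulr0.
(* The units used are distinct, so a nonzero coefficient is a nonzero coordinate of [w]. *)
have w0 : 0 < `|w|.
  rewrite normr_gt0; apply: contraNneq ak => w0.
  by rewrite -(wp _ kM) w0.
exists (`|w|^-1 *: w); last first.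
  by move=> i iM; rewrite linearZ /= fctE phi0// scaler0.
split; first by rewrite normrZ normfV normr_id mulVf// gt_eqF.
move=> i; have [[l lM ->]|Nl] := pselect (exists2 l, (l < M.+1)%N & i = p M l).
  exists `|w|^-1; first by rewrite invr_ge0.
  by rewrite choice.pickleK -(wp _ lM).
exists 0 => //; rewrite mul0r.
transitivity (`|w|^-1 * w i) => //.
suff -> : w i = 0 by rewrite mulr0.
rewrite /w ell1_unit_sumE big1// => m _.
by case: eqP => [im|_]; [case: Nl; exists m|rewrite mulr0].
Qed.

End ell1_cone.

(** * Norm estimates in [X_f] and for the embedding *)

Section sierpinski_mass.
Context {R : realType} {f : nat -> rat}.
Implicit Type x : sierpinski R f.

Lemma mass_le_norm x F : increasing_sets f F -> mass x F <= `|x|.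
Proof.
move=> Fi; rewrite -lee_fin sierpinski_normE fineK ?sierpinski_norm_fin_num//.
exact: sierpinski_norm_ub.
Qed.

Lemma exists_mass_ge x e : e < `|x| ->
  exists2 F, increasing_sets f F & e <= mass x F.
Proof.
rewrite -lte_fin sierpinski_normE fineK ?sierpinski_norm_fin_num//.
by move=> /ereal_sup_gt[_ [F Fi <-]]; rewrite lte_fin => /ltW; exists F.
Qed.

Lemma mass_tail_le x e : 0 < e -> exists N, forall F, increasing_sets f F ->
  (forall i, i \in F -> (N <= i)%N) -> mass x F <= e.
Proof.
move=> e0; have /set_mem xX := sierpinski_valP x.
have /fine_cvgP[[n1 _ x_fin] /cvgr0Pnorm_lt/(_ _ e0)[n2 _ x_lt]] := xX.
(* Past [n1] the tail norm is finite, so [fine] is faithful; past [n2] it is less than [e]. *)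
exists (maxn n1 n2) => F Fi FN.
have /x_fin xfin : (n1 <= maxn n1 n2)%N by exact: leq_maxl.
have /x_lt : (n2 <= maxn n1 n2)%N by exact: leq_maxr.
move=> /(le_lt_trans (ler_norm _))/ltW; apply: le_trans.
rewrite -lee_fin /= fineK//; apply: le_trans (sierpinski_norm_ub _ Fi).
rewrite lee_fin /mass !big_seq ler_sum// => i iF.
by rewrite sierpinski_tailE FN// mulr1.
Qed.

End sierpinski_mass.

(** Boundedness of [T] gives [C]. Continuity of [S] at 0 sends a ball of radius [r] in [Y] into the
    unit ball; rescaling [T x] to norm [r / 2] gives [c]. *)
Lemma isomorphic_norm_bounds (R : realType) (E X : normedModType R)
    (Y : set X) (T : {linear E -> X}) (S : X -> E) :
  continuous T -> set_bij [set: E] Y T -> cancel T S ->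
  {within Y, continuous S} ->
  exists c C, [/\ 0 < c, 0 < C, forall x, c * `|x| <= `|T x| & forall x, `|T x| <= C * `|x|].
Proof.
move=> Tc [TY _ _] TS Sc.
have [C C0 TC] := pinfty_ex_gt0
  ((linear_boundedP T).1 (continuous_linear_bounded 0 (Tc 0))).
have Y0 : Y 0 by rewrite -(linear0 T); exact: TY.
have S0 : S 0 = 0 by rewrite -(linear0 T) TS.
have /cvgr0Pnorm_lt/(_ _ ltr01) : S y @[y --> within Y (nbhs (0 : X))] --> (0 : E).
  by rewrite -[X in _ --> X]S0 (nbhs_subspace_in Y0); exact: (Sc 0).
move=> /nbhs_ballP[r /= r0 Sr].
have r20 : 0 < r / 2 by exact: divr_gt0.
exists (r / 2), C; split=> // x.
have [->|x0] := eqVneq x 0; first by rewrite normr0 mulr0.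
have Tx0 : 0 < `|T x|.
  rewrite normr_gt0; apply: contra_neq x0 => Tx0.
  by rewrite -(TS x) Tx0 S0.
pose a := r / 2 / `|T x|.
have a0 : 0 < a by exact: divr_gt0.
have : `|S (T (a *: x))| < 1.
  apply: Sr; last exact: TY.
  rewrite -ball_normE/= sub0r normrN linearZ normrZ gtr0_norm//.
  by rewrite /a divfK ?gt_eqF//; lra.
rewrite TS normrZ gtr0_norm// /a mulrAC ltr_pdivrMr// mul1r => /ltW.
by [].
Qed.

(** * Non-embeddability of [c_0(l_1)] *)

Theorem theorem5p8 (R : realType) (f : nat -> rat) (f_bij : bijective f) :
  ~ exists Y : set (sierpinski R f),
      closed_subspace Y /\ isomorphic_to_subspace (c0_sum (ell1 R)) Y.
Proof.
move=> [Y [_ [T [S [Tc TY TS Sc]]]]].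
have [c [C [c0 C0 cT TC]]] := isomorphic_norm_bounds Tc TY TS Sc.
pose phi n : {linear ell1 R -> (nat -> R)} := val \o (T \o c0_single n).
have /choice[h hP] n := ell1_ray_norm1_deep (phi n).
have /choice[v] n : exists v : (nat -> nat -> R) * (nat -> {fset nat}),
    (forall j, [/\ (phi n @` ell1_ray_norm1 (h n)) (v.1 j),
      increasing_sets f (v.2 j) & c / 4 <= mass (v.1 j) (v.2 j)]) /\
    forall j k g h, (j < k)%N -> g \in v.2 j -> h \in v.2 k ->
      (g < h)%N /\ f g < f h.
  pose W := phi n @` ell1_ray_norm1 (h n).
  have mass_leC w F : W w -> increasing_sets f F -> mass w F <= C.
    move=> [y [y1 _] <-] Fi; apply: le_trans (mass_le_norm (T (c0_single n y)) Fi) _.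
    by apply: le_trans (TC _) _; rewrite c0_single_norm y1 mulr1.
  have small_tail w e : W w -> 0 < e -> exists N, forall F,
      increasing_sets f F -> (forall i, i \in F -> (N <= i)%N) -> mass w F <= e.
    by move=> [y _ <-]; exact: (mass_tail_le (T (c0_single n y))).
  have W_rich : rich W.
    split=> [a _ _ a01 [y yh <-] [z zh <-]|M].
      exists (a *: y + (1 - a) *: z); first exact: ell1_ray_norm1_convex.
      by rewrite linearP linearZ.
    by have [y yh y0] := hP n M; exists (phi n y) => //; exists y.
  (* Norms on [W] are at least [c], but the supremum need not be attained, hence [c / 2]; extraction
     needs the further gap down to [c / 4]. *)
  have W_large : uniformly_large f (c / 2) setT W.
    move=> _ [y [y1 _] <-].
    have [|F Fi eF] := @exists_mass_ge R f (T (c0_single n y)) (c / 2).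
      by apply: lt_le_trans (cT _); rewrite c0_single_norm y1; lra.
    by exists F.
  have c42 : 0 <= c / 4 < c / 2 by apply/andP; split; lra.
  have [v [G [vG Glt]]] :=
    exists_block_sequence mass_leC small_tail c42 W_rich W_large.
  by exists (v, G).
move=> vG.
have /choice[y yP] n : exists y : nat -> ell1 R, forall j,
    ell1_ray_norm1 (h n) (y j) /\ phi n (y j) = (v n).1 j.
  suff /choice[y yP] : forall j, exists z : ell1 R,
      ell1_ray_norm1 (h n) z /\ phi n z = (v n).1 j by exists y.
  by move=> j; have [[y hy yv] _ _] := (vG n).1 j; exists y.
have c4 : 0 < c / 4 by exact: divr_gt0.
have := @glue_blocks R f (c / 4) c4 (fun n => (v n).1) (fun n => (v n).2).
(* Enough copies that their number times [c / 4] exceeds [C]. *)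
move=> /(_ _ _ _ (iota 0 (Num.truncn (C / (c / 4))).+1) (iota_uniq _ _)).
case=> [n j|n j|n|a [j [F [a1 Fi]]]].
- by case: ((vG n).1 j).
- by case: ((vG n).1 j).
- exact: (vG n).2.
rewrite size_iota; apply/negP; rewrite -ltNge.
set s := iota _ _.
(* This vector has norm at most 1, so [T x] has mass at most [C] on every chain. *)
pose x : c0_sum (ell1 R) := \sum_(n <- s) c0_single n (a n *: y n (j n)).
have -> : \sum_(n <- s) a n *: (v n).1 (j n) = val (T x).
  rewrite /x raddf_sum raddf_sum; apply: eq_bigr => n _.
  by have [_ <-] := yP n (j n); rewrite -(linearZ_LR (phi n)).
apply: (@le_lt_trans _ _ C); last by rewrite -ltr_pdivrMr// truncnS_gt.
apply: le_trans (mass_le_norm _ Fi) _; apply: le_trans (TC _) _.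
rewrite ler_piMr ?(ltW C0)// c0_single_sum_norm_le ?iota_uniq// => n.
by have [[y1 _] _] := yP n (j n); rewrite normrZ a1 mul1r y1.
Qed.
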